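(* Let $F\colon\mathcal A\to\mathcal B$ be a functor between small categories. Let $\mathsf{Aut}(\mathcal B)$ be the groupoid of automorphisms of $\mathcal B$, with inclusion functor $\mathsf{Aut}(\mathcal B)\hookrightarrow\mathcal B$, and form in $\mathsf{Cat}$ the pullback of this inclusion along $F$: $$\mathcal K=\mathcal A\times_{\mathcal B}\mathsf{Aut}(\mathcal B),\qquad k\colon\mathcal K\to\mathcal A \text{ the projection to } \mathcal A.$$ Then $k\colon\mathcal K\to\mathcal A$ is the $\mathcal Z$-kernel of $F$ in $\mathsf{Cat}$, where $\mathcal Z$ is the ideal of functors that factor through a skeletal groupoid.
   Context: $\mathsf{Cat}$ is the category of small categories and functors. A skeletal groupoid is a small category in which every arrow is an automorphism (an isomorphism with equal domain and codomain). For a small category $\mathcal B$, $\mathsf{Aut}(\mathcal B)$ is the subcategory of $\mathcal B$ with the same objects and whose arrows are the automorphisms of $\mathcal B$. $\mathcal Z$ denotes the ideal of trivial morphisms in $\mathsf{Cat}$: those functors that factor through a skeletal groupoid. A functor $k\colon \mathcal K\to\mathcal A$ is a $\mathcal Z$-kernel of $F\colon\mathcal A\to\mathcal B$ if $Fk\in\mathcal Z$ and every functor $m$ with codomain $\mathcal A$ such that $Fm\in\mathcal Z$ factors uniquely through $k$. *)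

(* Defs.v *)
(* Stdlib only.  Small categories are presented with hom-types.  Cat is treated
   as a 1-category: equality of objects, arrows and functors is Leibniz
   equality, which is the usual strict equality in the presence of functional
   extensionality and proof irrelevance. *)
From Stdlib Require Import ProofIrrelevance FunctionalExtensionality Eqdep.

Set Implicit Arguments.
Unset Strict Implicit.
Unset Printing Implicit Defensive.

(* The universes of objects and arrows are fixed (monomorphic): all categories
   below are small in one and the same sense. *)
Record Category : Type := MkCategory {
  Ob :> Type;
  Hom : Ob -> Ob -> Type;
  idm : forall x, Hom x x;
  comp : forall x y z, Hom y z -> Hom x y -> Hom x z;
  comp_idl : forall x y (f : Hom x y), comp (idm y) f = f;
  comp_idr : forall x y (f : Hom x y), comp f (idm x) = f;
  comp_assoc : forall x y z w (h : Hom z w) (g : Hom y z) (f : Hom x y),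
    comp h (comp g f) = comp (comp h g) f
}.
Arguments Hom {c} x y.
Arguments idm {c} x.
Arguments comp {c x y z} g f.

Record Functor (A B : Category) : Type := MkFunctor {
  fobj :> A -> B;
  fmap : forall x y : A, Hom x y -> Hom (fobj x) (fobj y);
  fmap_id : forall x : A, fmap (idm x) = idm (fobj x);
  fmap_comp : forall (x y z : A) (g : Hom y z) (f : Hom x y),
    fmap (comp g f) = comp (fmap g) (fmap f)
}.
Arguments fmap {A B} F {x y} f : rename.

Definition fcomp (A B C : Category) (G : Functor B C) (F : Functor A B) :
  Functor A C.
Proof.
refine (@MkFunctor A C (fun x => G (F x)) (fun x y f => fmap G (fmap F f)) _ _).
- intros x; now rewrite !fmap_id.
- intros x y z g f; now rewrite !fmap_comp.
Defined.

Definition is_iso (C : Category) (x y : C) (f : Hom x y) : Prop :=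
  exists g : Hom y x, comp g f = idm x /\ comp f g = idm y.

Definition is_automorphism (C : Category) (x y : C) (f : Hom x y) : Prop :=
  x = y /\ is_iso f.

Definition is_skeletal_groupoid (C : Category) : Prop :=
  forall (x y : C) (f : Hom x y), is_automorphism f.

Lemma is_automorphism_id (C : Category) (x : C) : is_automorphism (idm x).
Proof. split; [reflexivity | exists (idm x); split; apply comp_idl]. Qed.

Lemma is_automorphism_comp (C : Category) (x y z : C)
  (g : Hom y z) (f : Hom x y) :
  is_automorphism g -> is_automorphism f -> is_automorphism (comp g f).
Proof.
intros [eyz [g' [Hg1 Hg2]]] [exy [f' [Hf1 Hf2]]].
split; [now rewrite exy |].
exists (comp f' g'); split.
- rewrite comp_assoc, <- (comp_assoc f' g' g), Hg1, comp_idr; exact Hf1.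
- rewrite comp_assoc, <- (comp_assoc g f f'), Hf2, comp_idr; exact Hg2.
Qed.

Lemma sig_ext (T : Type) (P : T -> Prop) (u v : {x : T | P x}) :
  proj1_sig u = proj1_sig v -> u = v.
Proof.
destruct u as [x hx], v as [y hy]; simpl.
apply subset_eq_compat.
Qed.

Definition Aut (B : Category) : Category.
Proof.
refine (@MkCategory (Ob B)
  (fun x y => {f : Hom x y | is_automorphism f})
  (fun x => exist _ (idm x) (is_automorphism_id x))
  (fun x y z g f => exist _ (comp (proj1_sig g) (proj1_sig f))
     (is_automorphism_comp (proj2_sig g) (proj2_sig f))) _ _ _);
intros; apply sig_ext; simpl.
- apply comp_idl.
- apply comp_idr.
- apply comp_assoc.
Defined.

Definition Aut_incl (B : Category) : Functor (Aut B) B :=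
  @MkFunctor (Aut B) B (fun x => x) (fun x y f => proj1_sig f)
    (fun x => eq_refl) (fun x y z g f => eq_refl).

Definition is_trivial (A B : Category) (F : Functor A B) : Prop :=
  exists (S : Category) (G : Functor A S) (H : Functor S B),
    is_skeletal_groupoid S /\ F = fcomp H G.

Definition is_Zkernel (A B K : Category) (F : Functor A B) (k : Functor K A) :
  Prop :=
  is_trivial (fcomp F k) /\
  forall (M : Category) (m : Functor M A), is_trivial (fcomp F m) ->
    exists! u : Functor M K, fcomp k u = m.

Definition is_pullback (A B C P : Category) (F : Functor A C) (G : Functor B C)
  (p : Functor P A) (q : Functor P B) : Prop :=
  fcomp F p = fcomp G q /\
  forall (D : Category) (m : Functor D A) (n : Functor D B),
    fcomp F m = fcomp G n ->
    exists! u : Functor D P, fcomp p u = m /\ fcomp q u = n.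

(* Pullbacks exist in Cat: the explicit model has as objects (resp. arrows) the
   pairs of objects (resp. arrows) with the same image.  Arrows of C with
   different endpoints are compared in the type of all arrows of C. *)
Definition arr (C : Category) (x y : C) (f : Hom x y) :
  {xy : C * C & Hom (fst xy) (snd xy)} :=
  existT (fun xy : C * C => Hom (fst xy) (snd xy)) (x, y) f.

Lemma arr_inj (C : Category) (x y : C) (f g : Hom x y) :
  arr f = arr g -> f = g.
Proof.
exact (inj_pair2 _ (fun xy : C * C => Hom (fst xy) (snd xy)) (x, y) f g).
Qed.

Lemma arr_id (C : Category) (x x' : C) : x = x' -> arr (idm x) = arr (idm x').
Proof. now intros []. Qed.

Lemma arr_comp (C : Category) (x y z x' y' z' : C)
  (g : Hom y z) (f : Hom x y) (g' : Hom y' z') (f' : Hom x' y') :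
  arr g = arr g' -> arr f = arr f' -> arr (comp g f) = arr (comp g' f').
Proof.
intros Hg Hf.
pose proof (f_equal (@projT1 _ _) Hg) as eg.
pose proof (f_equal (@projT1 _ _) Hf) as ef.
simpl in eg, ef; injection eg as ey ez; injection ef as ex _.
destruct ex, ey, ez.
now rewrite (arr_inj Hg), (arr_inj Hf).
Qed.

Lemma functor_ext (A B : Category) (F G : Functor A B) :
  (forall x : A, F x = G x) ->
  (forall (x y : A) (f : Hom x y), arr (fmap F f) = arr (fmap G f)) -> F = G.
Proof.
destruct F as [Fo Fm F1 F2], G as [Go Gm G1 G2]; simpl; intros Ho Hm.
assert (e : Fo = Go) by (now apply functional_extensionality); destruct e.
assert (e : Fm = Gm).
{ do 3 (apply functional_extensionality_dep; intro); now apply arr_inj. }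
destruct e.
now rewrite (proof_irrelevance _ F1 G1), (proof_irrelevance _ F2 G2).
Qed.

Lemma functor_eq_arr (A B : Category) (F G : Functor A B) :
  F = G -> forall (x y : A) (f : Hom x y), arr (fmap F f) = arr (fmap G f).
Proof. now intros []. Qed.

Lemma functor_eq_obj (A B : Category) (F G : Functor A B) :
  F = G -> forall x : A, F x = G x.
Proof. now intros []. Qed.

Definition pullback (A B C : Category) (F : Functor A C) (G : Functor B C) :
  Category.
Proof.
refine (@MkCategory {ab : A * B | F (fst ab) = G (snd ab)}
  (fun u v => {fg : Hom (fst (proj1_sig u)) (fst (proj1_sig v)) *
                    Hom (snd (proj1_sig u)) (snd (proj1_sig v))
              | arr (fmap F (fst fg)) = arr (fmap G (snd fg))})
  (fun u => exist _ (idm (fst (proj1_sig u)), idm (snd (proj1_sig u))) _)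
  (fun u v w g f =>
     exist _ (comp (fst (proj1_sig g)) (fst (proj1_sig f)),
              comp (snd (proj1_sig g)) (snd (proj1_sig f))) _) _ _ _).
- intros; apply sig_ext; destruct f as [[f1 f2] hf]; simpl.
  now rewrite !comp_idl.
- intros; apply sig_ext; destruct f as [[f1 f2] hf]; simpl.
  now rewrite !comp_idr.
- intros; apply sig_ext; simpl; now rewrite !comp_assoc.
Unshelve.
+ simpl; rewrite !fmap_id; apply arr_id, (proj2_sig u).
+ simpl; rewrite !fmap_comp.
  apply arr_comp; [exact (proj2_sig g) | exact (proj2_sig f)].
Defined.

Definition pullback_fst (A B C : Category) (F : Functor A C) (G : Functor B C) :
  Functor (pullback F G) A :=
  @MkFunctor (pullback F G) A (fun u => fst (proj1_sig u))
    (fun u v f => fst (proj1_sig f)) (fun u => eq_refl)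
    (fun u v w g f => eq_refl).

Definition pullback_snd (A B C : Category) (F : Functor A C) (G : Functor B C) :
  Functor (pullback F G) B :=
  @MkFunctor (pullback F G) B (fun u => snd (proj1_sig u))
    (fun u v f => snd (proj1_sig f)) (fun u => eq_refl)
    (fun u v w g f => eq_refl).

Lemma pullback_arr_ext (A B C : Category) (F : Functor A C) (G : Functor B C)
  (u v u' v' : pullback F G) (f : Hom u v) (f' : Hom u' v') :
  u = u' -> v = v' ->
  arr (fst (proj1_sig f)) = arr (fst (proj1_sig f')) ->
  arr (snd (proj1_sig f)) = arr (snd (proj1_sig f')) -> arr f = arr f'.
Proof.
intros eu ev; destruct eu, ev; intros H1 H2.
apply f_equal, sig_ext.
apply arr_inj in H1; apply arr_inj in H2.
destruct (proj1_sig f), (proj1_sig f'); simpl in *; now rewrite H1, H2.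
Qed.

Theorem pullbackP (A B C : Category) (F : Functor A C) (G : Functor B C) :
  is_pullback F G (pullback_fst F G) (pullback_snd F G).
Proof.
split.
- apply functor_ext.
  + intros u; exact (proj2_sig u).
  + intros u v f; exact (proj2_sig f).
- intros D m n e.
  unshelve eexists.
  + unshelve refine (@MkFunctor D (pullback F G)
      (fun x => exist _ (m x, n x) (functor_eq_obj e x))
      (fun x y f => exist _ (fmap m f, fmap n f) (functor_eq_arr e f)) _ _).
    * intros x; apply sig_ext; simpl; now rewrite !fmap_id.
    * intros x y z g f; apply sig_ext; simpl; now rewrite !fmap_comp.
  + split.
    * split; apply functor_ext; reflexivity.
    * intros u [Hm Hn].
      assert (Ho : forall x : D, exist _ (m x, n x) (functor_eq_obj e x) = u x).
      { intros x; apply sig_ext; simpl.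
        rewrite <- (functor_eq_obj Hm x), <- (functor_eq_obj Hn x); simpl.
        now destruct (proj1_sig (u x)). }
      apply functor_ext; [exact Ho |].
      intros x y f; apply pullback_arr_ext; try apply Ho; simpl.
      -- symmetry; exact (functor_eq_arr Hm f).
      -- symmetry; exact (functor_eq_arr Hn f).
Qed.

(* Main.v *)
Require Import Defs.

(** A functor is trivial exactly when it sends every arrow to an automorphism.
    Automorphisms are preserved by functors, so a functor through a skeletal
    groupoid has this property ([is_trivial_automorphism]); conversely the
    category [Aut B] is itself a skeletal groupoid ([Aut_skeletal]), and a
    functor whose arrows land in automorphisms lifts along [Aut_incl B]
    ([Aut_lift]).  The lift is unique, because the inclusion is a monomorphism
    ([Aut_incl_mono]).  So [Aut_incl B] is the universal trivial functor into
    [B]: a functor into [B] is trivial if and only if it factors through it, in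
    at most one way.

    Hence functors [m] into [A] with [fcomp F m] trivial are the same as pairs
    [(m, n)] with [fcomp F m = fcomp (Aut_incl B) n], that is, cones over the
    pullback square, and the universal property of the pullback becomes that of
    the kernel. *)

Set Implicit Arguments.
Unset Strict Implicit.
Unset Printing Implicit Defensive.

Lemma fcomp_assoc (A B C D : Category)
  (H : Functor C D) (G : Functor B C) (F : Functor A B) :
  fcomp H (fcomp G F) = fcomp (fcomp H G) F.
Proof. now apply functor_ext. Qed.

Lemma fmap_automorphism (A B : Category) (F : Functor A B) (x y : A)
  (f : Hom x y) : is_automorphism f -> is_automorphism (fmap F f).
Proof.
intros [exy [g [Hg1 Hg2]]]; split; [now rewrite exy |].
exists (fmap F g); split.
- now rewrite <- fmap_comp, Hg1, fmap_id.
- now rewrite <- fmap_comp, Hg2, fmap_id.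
Qed.

(** Equal functors send an arrow into different hom-types; this carries the
    property from one to the other. *)
Lemma is_automorphism_arr (C : Category) (x y x' y' : C)
  (f : Hom x y) (f' : Hom x' y') :
  arr f = arr f' -> is_automorphism f -> is_automorphism f'.
Proof.
intros e Hf.
change (is_automorphism (projT2 (arr f'))).
now rewrite <- e.
Qed.

Lemma is_trivial_automorphism (A B : Category) (F : Functor A B) :
  is_trivial F -> forall (x y : A) (f : Hom x y), is_automorphism (fmap F f).
Proof.
intros (S & G & H & HS & e) x y f.
apply (is_automorphism_arr (eq_sym (functor_eq_arr e f))).
exact (fmap_automorphism H (HS _ _ (fmap G f))).
Qed.

(** The inverse of an automorphism is again an automorphism, so it is an arrow
    of [Aut B] and remains an inverse there. *)
Lemma Aut_skeletal (B : Category) : is_skeletal_groupoid (Aut B).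
Proof.
intros x y [f [exy [g [Hg1 Hg2]]]].
assert (Hg : is_automorphism g).
{ split; [now symmetry | now exists f]. }
split; [exact exy |].
exists (exist _ g Hg); split; now apply sig_ext.
Qed.

Definition Aut_lift (A B : Category) (F : Functor A B)
  (HF : forall (x y : A) (f : Hom x y), is_automorphism (fmap F f)) :
  Functor A (Aut B).
Proof.
refine (@MkFunctor A (Aut B) (fun x => F x)
  (fun x y f => exist _ (fmap F f) (HF x y f)) _ _).
- intros x; apply sig_ext; apply fmap_id.
- intros x y z g f; apply sig_ext; apply fmap_comp.
Defined.

Lemma Aut_incl_lift (A B : Category) (F : Functor A B)
  (HF : forall (x y : A) (f : Hom x y), is_automorphism (fmap F f)) :
  fcomp (Aut_incl B) (Aut_lift HF) = F.
Proof. now apply functor_ext. Qed.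

Lemma Aut_arr_ext (B : Category) (x y x' y' : Aut B)
  (f : Hom x y) (f' : Hom x' y') :
  arr (fmap (Aut_incl B) f) = arr (fmap (Aut_incl B) f') -> arr f = arr f'.
Proof.
intros e.
pose proof (f_equal (@projT1 _ _) e) as exy.
simpl in exy; injection exy as ex ey; destruct ex, ey.
apply f_equal, sig_ext; exact (arr_inj e).
Qed.

Lemma Aut_incl_mono (A B : Category) (G H : Functor A (Aut B)) :
  fcomp (Aut_incl B) G = fcomp (Aut_incl B) H -> G = H.
Proof.
intros e; apply functor_ext.
- exact (functor_eq_obj e).
- intros x y f; exact (Aut_arr_ext (functor_eq_arr e f)).
Qed.

Theorem proposition5p1 (A B : Category) (F : Functor A B)
  (K : Category) (k : Functor K A) (q : Functor K (Aut B))
  (hK : is_pullback F (Aut_incl B) k q) :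
  is_Zkernel F k.
Proof.
destruct hK as [square universal]; split.
- exists (Aut B), q, (Aut_incl B); split; [apply Aut_skeletal | exact square].
- intros M m Hm.
  set (n := Aut_lift (is_trivial_automorphism Hm)).
  assert (en : fcomp F m = fcomp (Aut_incl B) n).
  { symmetry; apply Aut_incl_lift. }
  destruct (universal M m n en) as [u [[Hk _] uniq]].
  exists u; split; [exact Hk |].
  intros v Hv; apply uniq; split; [exact Hv |].
  (* The second projection of [v] is forced by the first, [Aut_incl B] being a
     monomorphism. *)
  apply Aut_incl_mono.
  now rewrite fcomp_assoc, <- square, <- fcomp_assoc, Hv.
Qed.
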